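(* Let $d\geq 2$. If $g:\mathbb{R}^{d-1}\to\mathbb{R}$ is a semiconcave function, then $\operatorname{graph} g\in\mathcal{D}_d$.
   Context: A real function on an open convex set $C\subset\mathbb{R}^k$ is called DC if it is the difference of two convex functions on $C$. A function $f:C\to\mathbb{R}$ is called semiconcave if there exist $a>0$ and a convex function $h$ on $C$ such that $f(x)=a|x|^2-h(x)$ for all $x\in C$, where $|\cdot|$ is the Euclidean norm. For nonempty $A\subset\mathbb{R}^d$ put $d_A(x):=\operatorname{dist}(x,A)=\inf_{a\in A}|x-a|$. The system $\mathcal{D}_d$ consists of the empty set together with all nonempty closed sets $A\subset\mathbb{R}^d$ such that $d_A$ is DC on $\mathbb{R}^d$. Here $\operatorname{graph} g=\{(x,g(x)):x\in\mathbb{R}^{d-1}\}\subset\mathbb{R}^{d-1}\times\mathbb{R}=\mathbb{R}^d$. *)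

(* Defs.v *)
From HB Require Import structures.
From mathcomp Require Import all_boot all_order all_algebra.
From mathcomp Require Import all_classical all_reals all_analysis.

Set Implicit Arguments.
Unset Strict Implicit.
Unset Printing Implicit Defensive.

Import Order.TTheory GRing.Theory Num.Theory.
Import numFieldNormedType.Exports.

Local Open Scope classical_set_scope.
Local Open Scope ring_scope.

(* The library's norm `|x| on 'rV[R]_k is the sup norm, hence the explicit
   Euclidean norm; both induce the topology used by [closed] below. *)
Definition enorm (R : realType) (k : nat) (x : 'rV[R]_k) : R :=
  Num.sqrt (\sum_(i < k) x ord0 i ^+ 2).

(* [DC] and [semiconcave] are meant for C open and convex; only the values of
   f on C matter. *)
Definition DC (R : realType) (k : nat) (C : set 'rV[R]_k)
    (f : 'rV[R]_k -> R) : Prop :=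
  exists u v : 'rV[R]_k -> R,
    [/\ convex_function C u, convex_function C v &
        forall x, C x -> f x = u x - v x].

Definition semiconcave (R : realType) (k : nat) (C : set 'rV[R]_k)
    (f : 'rV[R]_k -> R) : Prop :=
  exists (a : R) (h : 'rV[R]_k -> R),
    [/\ 0 < a, convex_function C h &
        forall x, C x -> f x = a * enorm x ^+ 2 - h x].

(* For A empty this is the junk value inf set0 = 0. *)
Definition dist_to (R : realType) (d : nat) (A : set 'rV[R]_d)
    (x : 'rV[R]_d) : R :=
  inf [set enorm (x - a) | a in A].

Definition in_D (R : realType) (d : nat) (A : set 'rV[R]_d) : Prop :=
  A = set0 \/ [/\ A !=set0, closed A & DC setT (dist_to A)].

(* R^n x R is identified with R^(n + 1) by appending the last coordinate. *)
Definition graph_of (R : realType) (n : nat) (g : 'rV[R]_n -> R) :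
    set 'rV[R]_(n + 1) :=
  [set row_mx x (g x)%:M | x in setT].

(* Main.v *)
Require Import Defs.
From mathcomp Require Import all_boot all_order all_algebra.
From mathcomp Require Import all_classical all_reals all_analysis.
From mathcomp Require Import ring lra.

Set Implicit Arguments.
Unset Strict Implicit.
Unset Printing Implicit Defensive.

Import Order.TTheory GRing.Theory Num.Theory.
Import numFieldNormedType.Exports.

Local Open Scope classical_set_scope.
Local Open Scope ring_scope.

(** Write g = a |x|^2 - h with h convex, let A be the graph of g, let K be its
    hypograph, and put r = 1/(2a).

    Semiconcavity says that K has reach at least r, with the same r at every
    boundary point: the function t - g(x) becomes convex after adding a |x|^2,
    and its gradients have last coordinate 1, hence norm at least 1.
    Geometrically, a ball of radius r can roll along A without entering K
    ([rolling_ball]). Let E be the set of the points at distance at least r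
    from K, that is, of the possible centers of the rolling ball. Then the
    signed distance s to A, negative in K, controls all three distances:
    d_A = |s|, d_K = max(s, 0) and d_E = max(r - s, 0)
    ([DC_dist_of_rolling_ball]).

    For every nonempty set B the function |z|^2 - d_B(z)^2 is convex, being a
    supremum of affine functions ([convex_sqr_enorm_sub_sqr_dist]). Applied to
    E and K this yields convex functions u and v, and u - v = d_K^2 - d_E^2 is
    an increasing function of s. Thus d_A = |s| is a function of u - v. It has
    a convex kink at s = 0, where u - v = - r^2; once that kink is subtracted,
    a concave function with slopes in [- 1/r, 0] remains. Negated and
    increased by v/r, that function of u - v is a supremum of affine functions
    of (u, v) with nonnegative weights, hence convex in z. The pair of convex
    functions obtained is explicit and global
    ([DC_dist_of_signed_dist]), so no passage from local to global DC
    decompositions takes place.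

    The topological input is the continuity of finite convex functions
    ([convex_continuous]). It makes distances to A attained, which also shows
    that A is closed, and it forces every segment leaving K to meet A. *)

(** * Euclidean inner product and norm *)

Definition dot (R : realType) (k : nat) (x y : 'rV[R]_k) : R :=
  \sum_(i < k) x ord0 i * y ord0 i.

Lemma dotC (R : realType) (k : nat) (x y : 'rV[R]_k) : dot x y = dot y x.
Proof. by apply: eq_bigr => i _; rewrite mulrC. Qed.

Lemma dotDl (R : realType) (k : nat) (x y z : 'rV[R]_k) :
  dot (x + y) z = dot x z + dot y z.
Proof. by rewrite -big_split; apply: eq_bigr => i _; rewrite mxE mulrDl. Qed.

Lemma dotZl (R : realType) (k : nat) (c : R) (x y : 'rV[R]_k) :
  dot (c *: x) y = c * dot x y.
Proof. by rewrite mulr_sumr; apply: eq_bigr => i _; rewrite mxE mulrA. Qed.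

Lemma dotDr (R : realType) (k : nat) (x y z : 'rV[R]_k) :
  dot z (x + y) = dot z x + dot z y.
Proof. by rewrite dotC dotDl !(dotC _ z). Qed.

Lemma dotZr (R : realType) (k : nat) (c : R) (x y : 'rV[R]_k) :
  dot y (c *: x) = c * dot y x.
Proof. by rewrite dotC dotZl dotC. Qed.

Lemma dotNl (R : realType) (k : nat) (x y : 'rV[R]_k) : dot (- x) y = - dot x y.
Proof. by rewrite -scaleN1r dotZl mulN1r. Qed.

Lemma dotNr (R : realType) (k : nat) (x y : 'rV[R]_k) : dot y (- x) = - dot y x.
Proof. by rewrite dotC dotNl dotC. Qed.

Definition dotE := (dotDl, dotDr, dotZl, dotZr, dotNl, dotNr).

Lemma sqr_enorm (R : realType) (k : nat) (x : 'rV[R]_k) :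
  enorm x ^+ 2 = dot x x.
Proof.
rewrite sqr_sqrtr; last by apply: sumr_ge0 => i _; exact: sqr_ge0.
by apply: eq_bigr => i _; rewrite expr2.
Qed.

Lemma enorm_ge0 (R : realType) (k : nat) (x : 'rV[R]_k) : 0 <= enorm x.
Proof. exact: sqrtr_ge0. Qed.

Lemma ler_sqr_ge0 (R : realType) (x y : R) :
  0 <= y -> x ^+ 2 <= y ^+ 2 -> x <= y.
Proof.
by move=> y0 xy; rewrite leNgt; apply/negP => yx; rewrite !expr2 in xy; nra.
Qed.

Lemma enorm_eq0 (R : realType) (k : nat) (x : 'rV[R]_k) : enorm x = 0 -> x = 0.
Proof.
move=> x0; apply/rowP => i; rewrite mxE.
have := sqr_enorm x; rewrite x0 expr0n /= => /esym/eqP.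
rewrite psumr_eq0 => [|j _]; last by rewrite -expr2 sqr_ge0.
by move=> /allP/(_ i (mem_index_enum _)); rewrite mulf_eq0 orbb => /eqP.
Qed.

Lemma enormZ (R : realType) (k : nat) (c : R) (x : 'rV[R]_k) :
  enorm (c *: x) = `|c| * enorm x.
Proof.
apply/eqP; rewrite eq_le.
by apply/andP; split; apply: ler_sqr_ge0;
  rewrite ?mulr_ge0 ?enorm_ge0 // exprMn !sqr_enorm !dotE -normrX ger0_norm
    ?sqr_ge0 // expr2 mulrA.
Qed.

Lemma enormN (R : realType) (k : nat) (x : 'rV[R]_k) : enorm (- x) = enorm x.
Proof. by rewrite -scaleN1r enormZ normrN1 mul1r. Qed.

Lemma enormB (R : realType) (k : nat) (x y : 'rV[R]_k) :
  enorm (x - y) = enorm (y - x).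
Proof. by rewrite -enormN opprB. Qed.

(** Expanding the square of the vector |y| x - |x| y of nonnegative length. *)
Lemma cauchy_schwarz (R : realType) (k : nat) (x y : 'rV[R]_k) :
  dot x y <= enorm x * enorm y.
Proof.
have [/enorm_eq0 ->|x0] := eqVneq (enorm x) 0.
  by rewrite -(scale0r 0) dotZl mul0r mulr_ge0 ?enorm_ge0.
have [/enorm_eq0 ->|y0] := eqVneq (enorm y) 0.
  by rewrite -(scale0r 0) dotZr mul0r mulr_ge0 ?enorm_ge0.
have {}x0 : 0 < enorm x by rewrite lt_def x0 enorm_ge0.
have {}y0 : 0 < enorm y by rewrite lt_def y0 enorm_ge0.
have := sqr_ge0 (enorm (enorm y *: x - enorm x *: y)).
rewrite sqr_enorm !dotE -!sqr_enorm (dotC y x) => h.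
have xy0 : 0 < enorm x * enorm y by rewrite mulr_gt0.
by rewrite -(ler_pM2l xy0); rewrite !expr2 in h; lra.
Qed.

Lemma enormD (R : realType) (k : nat) (x y : 'rV[R]_k) :
  enorm (x + y) <= enorm x + enorm y.
Proof.
apply: ler_sqr_ge0; first by rewrite addr_ge0 ?enorm_ge0.
rewrite sqrrD !sqr_enorm !dotE (dotC y x).
by have := cauchy_schwarz x y; lra.
Qed.

Lemma enorm_triangle (R : realType) (k : nat) (y x z : 'rV[R]_k) :
  enorm (x - z) <= enorm (x - y) + enorm (y - z).
Proof. by rewrite -(subrKA y) enormD. Qed.

(** * Distance functions *)

Lemma dist_to_le (R : realType) (d : nat) (A : set 'rV[R]_d) (z a : 'rV[R]_d) :
  A a -> dist_to A z <= enorm (z - a).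
Proof.
move=> Aa; apply: ge_inf; last by exists a.
by exists 0 => _ [b _ <-]; exact: enorm_ge0.
Qed.

Lemma le_dist_to (R : realType) (d : nat) (A : set 'rV[R]_d) (z : 'rV[R]_d)
    (m : R) :
  A !=set0 -> (forall a, A a -> m <= enorm (z - a)) -> m <= dist_to A z.
Proof.
move=> [a Aa] mA; apply: lb_le_inf; first by exists (enorm (z - a)), a.
by move=> _ [b Ab <-]; exact: mA.
Qed.

Lemma dist_to_ge0 (R : realType) (d : nat) (A : set 'rV[R]_d) (z : 'rV[R]_d) :
  A !=set0 -> 0 <= dist_to A z.
Proof. by move=> A0; apply: le_dist_to => // a _; exact: enorm_ge0. Qed.

Lemma dist_to_lip (R : realType) (d : nat) (A : set 'rV[R]_d) (z y : 'rV[R]_d) :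
  A !=set0 -> dist_to A z <= enorm (z - y) + dist_to A y.
Proof.
move=> A0; rewrite -lerBlDl; apply: le_dist_to => // a Aa.
rewrite lerBlDl; apply: le_trans (enorm_triangle y z a).
exact: dist_to_le.
Qed.

(** * Convex functions *)

(** Convexity with a plain real weight s, which makes it accessible to linear
    arithmetic. *)
Lemma convex_functionP (R : realType) (k : nat) (f : 'rV[R]_k -> R) :
  convex_function setT f <->
  forall (x y : 'rV[R]_k) (s : R), 0 <= s -> s <= 1 ->
    f (s *: x + (1 - s) *: y) <= s * f x + (1 - s) * f y.
Proof.
split=> [cf x y s s0 s1|cf t x y _ _]; last exact: cf.
exact: (cf (Itv01 s0 s1) x y (in_setT _) (in_setT _)).
Qed.

(** |z|^2 - d_A(z)^2 is the supremum over a in A of the affine functions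
    2 <z, a> - |a|^2. *)
Lemma convex_sqr_enorm_sub_sqr_dist (R : realType) (d : nat)
    (A : set 'rV[R]_d) :
  A !=set0 ->
  convex_function setT (fun z => enorm z ^+ 2 - dist_to A z ^+ 2).
Proof.
move=> A0; apply/convex_functionP => x y s s0 s1.
set z := s *: x + _; set B := (X in _ <= X).
have below m : (forall a, A a -> m <= enorm (z - a) ^+ 2) ->
    m <= dist_to A z ^+ 2.
  move=> mA; have [m0|m0] := leP m 0; first exact: le_trans (sqr_ge0 _).
  rewrite -(sqr_sqrtr (ltW m0)) lerXn2r ?nnegrE ?sqrtr_ge0 ?dist_to_ge0 //.
  apply: le_dist_to => // a Aa; apply: ler_sqr_ge0; first exact: enorm_ge0.
  by rewrite sqr_sqrtr ?mA // ltW.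
suff : enorm z ^+ 2 - B <= dist_to A z ^+ 2 by lra.
apply: below => a Aa.
have near_a w : dist_to A w ^+ 2 <= enorm (w - a) ^+ 2.
  by rewrite lerXn2r ?nnegrE ?enorm_ge0 ?dist_to_ge0 ?dist_to_le.
have /(ler_wpM2l s0) hx := near_a x.
have s1' : 0 <= 1 - s by lra.
have /(ler_wpM2l s1') hy := near_a y.
rewrite !sqr_enorm !dotE (dotC a) in hx.
rewrite !sqr_enorm !dotE (dotC a) in hy.
rewrite {}/B {}/z !sqr_enorm !dotE (dotC y x) (dotC a x) (dotC a y).
lra.
Qed.

Lemma convex_affine_comb (R : realType) (k : nat) (f g : 'rV[R]_k -> R)
    (a b c : R) : 0 <= a -> 0 <= b ->
  convex_function setT f -> convex_function setT g ->
  convex_function setT (fun z => c + a * f z + b * g z).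
Proof.
move=> a0 b0 /convex_functionP cf /convex_functionP cg.
apply/convex_functionP => x y s s0 s1.
have /(ler_wpM2l a0) := cf x y s s0 s1; have /(ler_wpM2l b0) := cg x y s s0 s1.
lra.
Qed.

(** A pointwise supremum that is attained everywhere, in the form in which the
    convexity of an explicitly given function is checked. *)
Lemma convex_supported (R : realType) (k : nat) (f : 'rV[R]_k -> R) :
  (forall z, exists l : 'rV[R]_k -> R,
    [/\ convex_function setT l, forall w, l w <= f w & l z = f z]) ->
  convex_function setT f.
Proof.
move=> supp; apply/convex_functionP => x y s s0 s1.
have [l [/convex_functionP cl lf <-]] := supp (s *: x + (1 - s) *: y).
apply: le_trans (cl x y s s0 s1) _.
by rewrite lerD // ler_wpM2l // subr_ge0.
Qed.

Lemma convex_max (R : realType) (k : nat) (f g : 'rV[R]_k -> R) :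
  convex_function setT f -> convex_function setT g ->
  convex_function setT (fun z => Num.max (f z) (g z)).
Proof.
move=> cf cg; apply: convex_supported => z.
have [gf|/ltW fg] := leP (g z) (f z).
- by exists f; split=> // w; rewrite le_max lexx.
- by exists g; split=> // w; rewrite le_max lexx orbT.
Qed.

(** * Recovering the distance from two convex functions *)

(** With N = |z|^2, u = N - e^2 and v = N - k^2, this is
    max(r^2 + u, v) / r - a, up to the summand N / r. For e, k and a the
    distances to E, K and A, the first term is convex in z as a maximum of
    convex functions; the point is that the whole expression is convex too. *)
Definition profile (R : realType) (r e k a : R) : R :=
  Num.max (r ^+ 2 - e ^+ 2) (- k ^+ 2) / r - a.

(** The two families of tangents to the profile, again up to the summand N / r:
    the first is r - y/2 + u/(2y) + (1/r - 1/(2y)) v, the second has the weights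
    of u and v exchanged. They come from the tangents of the square root
    at y^2: the first family is the one that touches when s <= 0, where
    d_E = r - s = y, the second one when s >= r, where d_K = s = y. The two
    agree at y = r, the value for the points in between. Since y >= r, all
    weights are nonnegative. *)
Definition tangent_inner (R : realType) (r y e k : R) : R :=
  r - y / 2 - (2 * y)^-1 * e ^+ 2 - (r^-1 - (2 * y)^-1) * k ^+ 2.

Definition tangent_outer (R : realType) (r y e k : R) : R :=
  r - y / 2 - (r^-1 - (2 * y)^-1) * e ^+ 2 - (2 * y)^-1 * k ^+ 2.

(** The values of d_A, d_K and d_E at signed distance s, in the three regions
    K, the shell of width r outside K, and E. *)
Variant shell_spec (R : realType) (r s : R) : R -> R -> R -> Prop :=
| ShellInner of s <= 0 : shell_spec r s (- s) 0 (r - s)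
| ShellMiddle of 0 <= s & s <= r : shell_spec r s s s (r - s)
| ShellOuter of r <= s : shell_spec r s s s 0.

Lemma shellP (R : realType) (r s : R) : 0 < r ->
  shell_spec r s `|s| (Num.max s 0) (Num.max (r - s) 0).
Proof.
move=> r0; have [s0|s0] := leP s 0.
  have rs : 0 <= r - s by lra.
  by rewrite (max_l rs) ler0_norm //; exact: ShellInner.
rewrite gtr0_norm //; have [rs|rs] := leP (r - s) 0.
  by apply: ShellOuter; lra.
by apply: ShellMiddle; lra.
Qed.

(** Outside the shell both bounds follow from t <= y/2 + t^2/(2y), the
    inequality between arithmetic and geometric means; inside it the slack is
    1/(2y) times a sum of products of the nonnegative numbers s, r - s and
    y - r. *)
Lemma tangent_le_profile (R : realType) (r y s : R) : 0 < r -> r <= y ->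
  let e := Num.max (r - s) 0 in let k := Num.max s 0 in
  tangent_inner r y e k <= profile r e k `|s| /\
  tangent_outer r y e k <= profile r e k `|s|.
Proof.
move=> r0 ry /=; have y0 : 0 < y by lra.
rewrite /profile /tangent_inner /tangent_outer.
set al := (2 * y)^-1; set p := r^-1.
have al0 : 0 < al by rewrite invr_gt0; lra.
have aly : al * y = 1 / 2 by rewrite /al; field; lra.
have pr : p * r = 1 by rewrite /p mulVf //; lra.
have alp : 2 * al <= p.
  have -> : p = 2 * al * (y / r) by rewrite /p /al; field; lra.
  by rewrite ler_pMr ?ler_pdivlMr ?mul1r //; lra.
have sq (t : R) : t <= y / 2 + al * t ^+ 2.
  have : 0 <= al * (t - y) ^+ 2 by rewrite mulr_ge0 ?sqr_ge0 ?ltW.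
  have -> : al * (t - y) ^+ 2 = al * t ^+ 2 - 2 * (al * y) * t + (al * y) * y.
    by ring.
  by rewrite aly; lra.
have sq' (t : R) : t <= y / 2 + (p - al) * t ^+ 2.
  apply: le_trans (sq t) _; rewrite lerD2l ler_wpM2r ?sqr_ge0 //; lra.
case: (shellP s r0) => [s0|s0 sr|rs].
- have := sq (r - s); have := sq' (r - s).
  rewrite max_r ?expr0n /=; last by have := sqr_ge0 (r - s); nra.
  by rewrite oppr0 mul0r; lra.
- rewrite max_l; last by nra.
  have -> : (r ^+ 2 - (r - s) ^+ 2) * p =
    (p * r) * (2 * s) - p * s ^+ 2 by ring.
  rewrite pr.
  have e1 : p * (r - s) ^+ 2 =
    (p * r) * r - 2 * (p * r) * s + p * s ^+ 2 by ring.
  rewrite pr in e1.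
  have h1 : 0 <= s * (y - r) * al by rewrite !mulr_ge0 //; lra.
  have h2 := sq r.
  have h3 : 0 <= al * ((y - r) * (y + r - 2 * s)).
    by rewrite !mulr_ge0 //; lra.
  have e2 : s * (y - r) * al = (al * y) * s - al * r * s by ring.
  have e3 : al * ((y - r) * (y + r - 2 * s)) =
    (al * y) * y - 2 * (al * y) * s - al * r ^+ 2 + 2 * al * r * s by ring.
  rewrite aly in e2 e3.
  by split; [lra | rewrite mulrBl e1; lra].
- have := sq s; have := sq' s.
  rewrite expr0n /= max_l; last by have := sqr_ge0 s; nra.
  have -> : (r ^+ 2 - 0) * p = (p * r) * r by ring.
  by rewrite pr; lra.
Qed.

Lemma profile_tangent (R : realType) (r s : R) : 0 < r ->
  let e := Num.max (r - s) 0 in let k := Num.max s 0 in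
  exists2 y, r <= y & tangent_inner r y e k = profile r e k `|s| \/
                      tangent_outer r y e k = profile r e k `|s|.
Proof.
move=> r0; rewrite /= /profile /tangent_inner /tangent_outer.
case: (shellP s r0) => [s0|s0 sr|rs].
- exists (r - s); first lra.
  left; rewrite max_r ?expr0n /=; last by have := sqr_ge0 (r - s); nra.
  by field; lra.
- exists r => //; left; rewrite max_l; last by nra.
  by field; lra.
- exists s => //; right.
  rewrite expr0n /= max_l; last by have := sqr_ge0 s; nra.
  by field; lra.
Qed.

(** For s between 0 and r the functions d_K = s and d_E = r - s satisfy
    d_K^2 - d_E^2 = r (2s - r), so squared distances, which are DC without any
    assumption, determine s; outside the shell they determine it through a
    square root with bounded slope. *)
Lemma DC_dist_of_signed_dist (R : realType) (d : nat) (A K E : set 'rV[R]_d)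
    (r : R) : 0 < r -> K !=set0 -> E !=set0 ->
  (forall z, exists s, [/\ dist_to A z = `|s|, dist_to K z = Num.max s 0 &
                           dist_to E z = Num.max (r - s) 0]) ->
  DC setT (dist_to A).
Proof.
move=> r0 K0 E0 signed.
pose u (z : 'rV[R]_d) := enorm z ^+ 2 - dist_to E z ^+ 2.
pose v (z : 'rV[R]_d) := enorm z ^+ 2 - dist_to K z ^+ 2.
have cu : convex_function setT u by exact: convex_sqr_enorm_sub_sqr_dist.
have cv : convex_function setT v by exact: convex_sqr_enorm_sub_sqr_dist.
pose M z := Num.max (r ^+ 2 + u z) (v z) / r.
exists M, (fun z => M z - dist_to A z); split; last by move=> z _; lra.
- have cru : convex_function setT (fun z => r ^+ 2 + u z).
    suff -> : (fun z => r ^+ 2 + u z) = (fun z => r ^+ 2 + 1 * u z + 0 * v z).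
      exact: convex_affine_comb.
    by apply/funext => z; lra.
  suff -> : M = (fun z => 0 + r^-1 * Num.max (r ^+ 2 + u z) (v z) + 0 * v z).
    have r1 : 0 <= r^-1 by rewrite invr_ge0 ltW.
    exact: (convex_affine_comb 0 r1 (lexx 0) (convex_max cru cv) cv).
  by apply/funext => z; rewrite /M; lra.
have profileE z : M z - dist_to A z = enorm z ^+ 2 / r +
    profile r (dist_to E z) (dist_to K z) (dist_to A z).
  rewrite /M /profile /u /v.
  have -> : r ^+ 2 + (enorm z ^+ 2 - dist_to E z ^+ 2) =
    enorm z ^+ 2 + (r ^+ 2 - dist_to E z ^+ 2) by lra.
  by rewrite -addr_maxr mulrDl addrA.
(* What is left is the convexity of M - d_A. *)
apply: convex_supported => z.
have [s [As Ks Es]] := signed z.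
have [y ry touch] := profile_tangent s r0.
have y2 : 0 <= (2 * y)^-1 by rewrite invr_ge0; lra.
have y2r : 0 <= r^-1 - (2 * y)^-1.
  by rewrite subr_ge0 lef_pV2 ?posrE; lra.
case: touch => touch.
- exists (fun w => r - y / 2 + (2 * y)^-1 * u w + (r^-1 - (2 * y)^-1) * v w).
  split; first exact: convex_affine_comb.
    move=> w; rewrite profileE; have [t [-> Kt Et]] := signed w.
    have [+ _] := tangent_le_profile t r0 ry.
    by rewrite -Kt -Et /tangent_inner /u /v; lra.
  rewrite profileE As; rewrite -Es -Ks in touch.
  by rewrite -touch /tangent_inner /u /v; lra.
- exists (fun w => r - y / 2 + (r^-1 - (2 * y)^-1) * u w + (2 * y)^-1 * v w).
  split; first exact: convex_affine_comb.
    move=> w; rewrite profileE; have [t [-> Kt Et]] := signed w.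
    have [_ +] := tangent_le_profile t r0 ry.
    by rewrite -Kt -Et /tangent_outer /u /v; lra.
  rewrite profileE As; rewrite -Es -Ks in touch.
  by rewrite -touch /tangent_outer /u /v; lra.
Qed.

(** * Sets outside which a ball can roll *)

(** If z outside K has nearest point p, the ball of radius r that touches K at p
    has its center c on the ray from p through z. So c lies in E and
    |z - c| = r - d_A(z), whence d_E = r - d_A in the shell. Letting z tend to
    a point of A shows that points of A are at distance r from E. Inside K,
    every segment from z to E first crosses A, which gives d_E = r + d_A
    there. *)
Lemma DC_dist_of_rolling_ball (R : realType) (d : nat) (K A : set 'rV[R]_d)
    (r : R) : 0 < r -> A !=set0 -> A `<=` K ->
  (forall z w, K z -> ~ K w ->
     exists2 q, A q & enorm (z - w) = enorm (z - q) + enorm (q - w)) ->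
  (forall z, exists2 p, A p & dist_to A z = enorm (z - p)) ->
  (forall p e, A p -> 0 < e -> exists2 z, ~ K z & enorm (p - z) <= e) ->
  (forall z p, ~ K z -> A p ->
     (forall q, K q -> enorm (z - p) <= enorm (z - q)) ->
     forall q, K q -> r <= enorm (p + (r / enorm (z - p)) *: (z - p) - q)) ->
  DC setT (dist_to A).
Proof.
move=> r0 A0 AK cross nearest outside roll.
have K0 : K !=set0 by have [p /AK] := A0; exists p.
pose E := [set c : 'rV[R]_d | r <= dist_to K c].
have KE z : K z -> dist_to K z = 0.
  move=> Kz; apply/le_anti; rewrite dist_to_ge0 // andbT.
  by have := dist_to_le z Kz; rewrite subrr -(scale0r 0) enormZ normr0 mul0r.
have nKE z : ~ K z -> dist_to K z = dist_to A z.
  move=> nKz; apply/le_anti/andP; split.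
    by apply: le_dist_to => // p /AK; exact: dist_to_le.
  apply: le_dist_to => // q Kq; have [p Ap] := cross _ _ Kq nKz.
  rewrite (enormB z) => ->; have := dist_to_le z Ap; rewrite enormB.
  by have := enorm_ge0 (q - p); lra.
have A_gt0 z : ~ K z -> 0 < dist_to A z.
  move=> nKz; rewrite lt_def dist_to_ge0 // andbT.
  have [p Ap ->] := nearest z; apply/eqP => /enorm_eq0 /eqP.
  by rewrite subr_eq0 => /eqP zp; apply: nKz; rewrite zp; exact: AK.
have center z : ~ K z -> dist_to A z <= r ->
    exists2 c, E c & enorm (z - c) = r - dist_to A z.
  move=> nKz zr; have [p Ap zp] := nearest z.
  have s0 := A_gt0 _ nKz; set s := dist_to A z in zp s0 zr *.
  exists (p + (r / s) *: (z - p)).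
    apply: le_dist_to => // q Kq; rewrite zp; apply: roll => // {}q {}Kq.
    by rewrite -zp /s -nKE //; exact: dist_to_le.
  have -> : z - (p + (r / s) *: (z - p)) = (1 - r / s) *: (z - p).
    by rewrite scalerBl scale1r opprD addrA.
  have rs : r / s * s = r by rewrite divfK ?gt_eqF.
  have rs1 : 1 <= r / s by rewrite ler_pdivlMr ?mul1r.
  by rewrite enormZ ler0_norm ?subr_le0 // -zp opprB mulrBl mul1r rs.
have E_near_A p : A p -> forall e, 0 < e ->
    exists2 c, E c & enorm (p - c) <= r + e.
  (* The bound by r keeps z in the shell, where [center] applies. *)
  move=> Ap e e0; pose e' := Num.min e r.
  have e'0 : 0 < e' by rewrite lt_min e0 r0.
  have [z nKz pz] := outside p e' Ap e'0.
  have zr : dist_to A z <= r.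
    apply: le_trans (dist_to_le z Ap) _; rewrite enormB (le_trans pz) //.
    by rewrite ge_min lexx orbT.
  have [c Ec zc] := center z nKz zr; exists c => //.
  apply: le_trans (enorm_triangle z p c) _.
  have e'e : e' <= e by rewrite ge_min lexx.
  by have := A_gt0 _ nKz; rewrite zc; lra.
have E0 : E !=set0.
  by have [p Ap] := A0; have [c Ec _] := E_near_A _ Ap 1 ltr01; exists c.
have EK c : E c -> ~ K c by move=> Ec /KE c0; move: Ec; rewrite /E/= c0; lra.
apply: (DC_dist_of_signed_dist r0 K0 E0) => z.
have [Kz|nKz] := pselect (K z).
  have dA := dist_to_ge0 z A0.
  exists (- dist_to A z).
  rewrite normrN ger0_norm // max_r ?oppr_le0 // max_l; last by lra.
  split=> //; first exact: KE.
  apply/le_anti/andP; split.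
    apply/ler_addgt0Pl => e e0; have [p Ap ->] := nearest z.
    have [c Ec pc] := E_near_A p Ap e e0.
    apply: le_trans (dist_to_le z Ec) _.
    by apply: le_trans (enorm_triangle p z c) _; lra.
  apply: le_dist_to => // c Ec; have nKc := EK _ Ec.
  have [q Aq ->] := cross z c Kz nKc.
  have := dist_to_le z Aq; have := dist_to_le c (AK _ Aq).
  by rewrite (enormB c); move: Ec; rewrite /E/=; lra.
have dA := A_gt0 _ nKz.
exists (dist_to A z); rewrite gtr0_norm // max_l; last exact: ltW.
split=> //; first exact: nKE.
have [zr|/ltW rz] := leP (dist_to A z) r.
  rewrite max_l; last by lra.
  apply/le_anti/andP; split.
    by have [c Ec <-] := center z nKz zr; exact: dist_to_le.
  apply: le_dist_to => // c Ec.
  have := dist_to_lip c z K0; rewrite (nKE z) // (enormB c).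
  by move: Ec; rewrite /E/=; lra.
rewrite max_r; last by lra.
apply/le_anti; rewrite dist_to_ge0 // andbT.
have Ez : E z by rewrite /E/= nKE.
by have := dist_to_le z Ez; rewrite subrr -(scale0r 0) enormZ normr0 mul0r.
Qed.

(** * Continuity of convex functions *)

(** Along one axis, convexity between 0 and the two unit vectors gives a linear
    bound. Coordinates are then added one at a time: c_i e_i + v is the midpoint
    of 2 c_i e_i and 2 v. *)
Lemma convex_upper_lipschitz (R : realType) (n : nat) (F : 'rV[R]_n -> R)
    (s : seq 'I_n) : convex_function setT F -> F 0 = 0 ->
  exists C e, [/\ 0 <= C, 0 < e & forall c : 'rV[R]_n, `|c| <= e ->
    F (\sum_(i <- s) c ord0 i *: 'e_i) <= C * `|c|].
Proof.
move=> /convex_functionP cF F0; elim: s => [|i s [C [e [C0 e0 IH]]]].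
  by exists 0, 1; split=> // c _; rewrite big_nil F0 mul0r.
pose M := `|F 'e_i| + `|F (- 'e_i)|.
have axis (t : R) : `|t| <= 1 -> F (t *: 'e_i) <= `|t| * M.
  move=> t1; have M1 : F 'e_i <= M /\ F (- 'e_i) <= M.
    have := ler_norm (F 'e_i); have := ler_norm (F (- 'e_i)).
    have := normr_ge0 (F 'e_i); have := normr_ge0 (F (- 'e_i)).
    by rewrite /M; lra.
  have [t0|t0] := leP 0 t.
    rewrite ger0_norm // in t1 *; have := cF 'e_i 0 t t0 t1.
    rewrite scaler0 addr0 F0 mulr0 addr0 => /le_trans; apply.
    by rewrite ler_wpM2l //; case: M1.
  rewrite ltr0_norm // in t1 *; have t0' : 0 <= - t by lra.
  have := cF (- 'e_i) 0 (- t) t0' t1.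
  rewrite scaler0 addr0 F0 mulr0 addr0 scalerN scaleNr opprK.
  move=> /le_trans; apply.
  by rewrite ler_wpM2l //; case: M1.
have M0 : 0 <= M by rewrite /M addr_ge0.
exists (C + M), (Num.min (e / 2) (1 / 2)); split.
- by rewrite addr_ge0.
- by rewrite lt_min !divr_gt0.
move=> c; rewrite le_min => /andP[ce c1].
have half0 : 0 <= (1 / 2 : R) by lra.
have half1 : (1 / 2 : R) <= 1 by lra.
have := cF ((2 * c ord0 i) *: 'e_i) (\sum_(j <- s) (2 *: c) ord0 j *: 'e_j) _
  half0 half1.
have -> : (1 / 2 : R) *: ((2 * c ord0 i) *: 'e_i) +
    (1 - 1 / 2) *: (\sum_(j <- s) (2 *: c) ord0 j *: 'e_j) =
    \sum_(j <- i :: s) c ord0 j *: 'e_j :> 'rV[R]_n.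
  rewrite big_cons scalerA scaler_sumr; congr (_ + _).
    by congr (_ *: _); lra.
  by apply: eq_bigr => j _; rewrite mxE scalerA; congr (_ *: _); lra.
move=> /le_trans; apply.
have n2 : `|2 *: c| = 2 * `|c| by rewrite mx_normZ ger0_norm.
have ci : `|c ord0 i| <= `|c|.
  by rewrite -[leRHS]/(mx_norm c) mx_normrE; exact: (le_bigmax _ _ (ord0, i)).
have := IH (2 *: c); rewrite n2 => /(_ _)/wrap[]; first by lra.
have := axis (2 * c ord0 i); rewrite normrM ger0_norm // => /(_ _)/wrap[].
  by lra.
have := ler_wpM2r M0 ci.
lra.
Qed.

(** The bound from above at x + c and at x - c gives the bound from below,
    because x is the midpoint of these points. *)
Lemma convex_continuous (R : realType) (n : nat) (h : 'rV[R]_n -> R) :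
  convex_function setT h -> continuous h.
Proof.
move=> /convex_functionP ch x.
pose F c := h (x + c) - h x.
have cF : convex_function setT F.
  apply/convex_functionP => y z s s0 s1; rewrite /F.
  have := ch (x + y) (x + z) s s0 s1.
  have -> : s *: (x + y) + (1 - s) *: (x + z) = x + (s *: y + (1 - s) *: z).
    rewrite !scalerDr addrACA -scalerDl.
    by rewrite (_ : s + (1 - s) = 1) ?scale1r //; lra.
  by lra.
have F0 : F 0 = 0 by rewrite /F addr0 subrr.
have [C [e [C0 e0 upper]]] := convex_upper_lipschitz (index_enum 'I_n) cF F0.
have {}upper c : `|c| <= e -> F c <= C * `|c|.
  by rewrite {2}(row_sum_delta c); exact: upper.
have lip c : `|c| <= e -> `|F c| <= C * `|c|.
  move=> ce; rewrite ler_norml upper // andbT.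
  have half0 : 0 <= (1 / 2 : R) by lra.
  have half1 : (1 / 2 : R) <= 1 by lra.
  have /convex_functionP/(_ c (- c) _ half0 half1) := cF.
  have -> : (1 / 2 : R) *: c + (1 - 1 / 2) *: - c = 0.
    by rewrite scalerN -scaleNr -scalerDl (_ : _ + _ = 0) ?scale0r //; lra.
  rewrite F0; have := upper (- c); rewrite normrN => /(_ ce).
  lra.
move=> /= P /(nbhs_ballP (h x)) [eps /= eps0 epsP]; apply/nbhs_ballP.
exists (Num.min e (eps / (C + 1))) => /=.
  by rewrite lt_min e0 divr_gt0 //; lra.
move=> y; rewrite -ball_normE /= lt_min => /andP[ye yeps].
apply: epsP; rewrite /ball /= distrC.
have := lip (y - x); rewrite /F (addrC x) subrK (distrC y) => /(_ (ltW ye)).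
move=> /le_lt_trans; apply.
rewrite ltr_pdivlMr in yeps; last by lra.
have := normr_ge0 (x - y); lra.
Qed.

(** * Graphs and hypographs *)

Definition pt (R : realType) (n : nat) (x : 'rV[R]_n) (t : R) :
    'rV[R]_(n + 1) :=
  row_mx x t%:M.

Lemma ptP (R : realType) (n : nat) (z : 'rV[R]_(n + 1)) :
  exists x t, z = pt x t.
Proof.
by exists (lsubmx z), (rsubmx z ord0 ord0); rewrite /pt -mx11_scalar hsubmxK.
Qed.

Lemma dot_pt (R : realType) (n : nat) (x y : 'rV[R]_n) (s t : R) :
  dot (pt x s) (pt y t) = dot x y + s * t.
Proof.
rewrite /dot big_split_ord /= big_ord1; congr (_ + _).
  by apply: eq_bigr => i _; rewrite !row_mxEl.
by rewrite !row_mxEr !mxE !mulr1n.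
Qed.

Lemma ptB (R : realType) (n : nat) (x y : 'rV[R]_n) (s t : R) :
  pt x s - pt y t = pt (x - y) (s - t).
Proof. by rewrite /pt opp_row_mx add_row_mx raddfB. Qed.

Lemma ptD (R : realType) (n : nat) (x y : 'rV[R]_n) (s t : R) :
  pt x s + pt y t = pt (x + y) (s + t).
Proof. by rewrite /pt add_row_mx raddfD. Qed.

Lemma ptZ (R : realType) (n : nat) (x : 'rV[R]_n) (c t : R) :
  c *: pt x t = pt (c *: x) (c * t).
Proof. by rewrite /pt scale_row_mx scale_scalar_mx. Qed.

Lemma sqr_enorm_pt (R : realType) (n : nat) (x : 'rV[R]_n) (t : R) :
  enorm (pt x t) ^+ 2 = dot x x + t ^+ 2.
Proof. by rewrite sqr_enorm dot_pt expr2. Qed.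

Definition hypograph (R : realType) (n : nat) (g : 'rV[R]_n -> R) :
    set 'rV[R]_(n + 1) :=
  [set z | rsubmx z ord0 ord0 <= g (lsubmx z)].

Lemma hypograph_pt (R : realType) (n : nat) (g : 'rV[R]_n -> R) (x : 'rV[R]_n)
  (t : R) : hypograph g (pt x t) <-> t <= g x.
Proof. by rewrite /hypograph /= row_mxKl row_mxKr !mxE mulr1n. Qed.

Lemma graph_of_pt (R : realType) (n : nat) (g : 'rV[R]_n -> R) (x : 'rV[R]_n) :
  graph_of g (pt x (g x)).
Proof. by exists x. Qed.

(** The intermediate value theorem for g(x) - t along the segment. *)
Lemma segment_meets_graph (R : realType) (n : nat) (g : 'rV[R]_n -> R)
    (z w : 'rV[R]_(n + 1)) : continuous g ->
  hypograph g z -> ~ hypograph g w ->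
  exists2 q, graph_of g q & enorm (z - w) = enorm (z - q) + enorm (q - w).
Proof.
move=> cg; have [x [s ->]] := ptP z; have [y [t ->]] := ptP w.
move=> /hypograph_pt sx /hypograph_pt /negP; rewrite -ltNge => ty.
pose line (c : R) := x + c *: (y - x).
pose phi (c : R) := g (line c) - (s + c * (t - s)).
have cline : continuous line.
  by move=> c; apply: cvgD; [exact: cvg_cst | apply: cvgZr_tmp; exact: cvg_id].
have cphi : continuous phi.
  move=> c; apply: cvgB.
    by apply: continuous_comp; [exact: cline | exact: cg].
  by apply: cvgD; [exact: cvg_cst | apply: cvgMr_tmp; exact: cvg_id].
have phi0 : phi 0 = g x - s by rewrite /phi /line scale0r addr0 mul0r addr0.
have phi1 : phi 1 = g y - t.
  by rewrite /phi /line scale1r mul1r !(addrC _ (_ - _)) !subrK.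
have [c] : exists2 c, c \in `[0, 1] & phi c = 0.
  apply: IVT => //; first exact: continuous_subspaceT.
  rewrite phi0 phi1 ge_min le_max.
  by apply/andP; split; apply/orP; [right | left]; lra.
rewrite in_itv /= => /andP[c0 c1] phic.
have phiE : g (line c) = s + c * (t - s) by move: phic; rewrite /phi; lra.
exists (pt (line c) (g (line c))); first exact: graph_of_pt.
have -> : pt x s - pt (line c) (g (line c)) = c *: (pt x s - pt y t).
  rewrite !ptB ptZ phiE /line opprD addrA subrr add0r -scalerN opprB.
  by congr pt; lra.
have -> : pt (line c) (g (line c)) - pt y t =
    (1 - c) *: (pt x s - pt y t).
  rewrite !ptB ptZ phiE /line scalerBl scale1r; congr pt; last by lra.
  by rewrite addrAC -scalerN opprB.
by rewrite !enormZ !ger0_norm //; lra.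
Qed.

Lemma sqr_enorm_continuous (R : realType) (k : nat) :
  continuous (fun x : 'rV[R]_k => enorm x ^+ 2).
Proof.
apply: convex_continuous; apply/convex_functionP => y z s s0 s1.
have : 0 <= s * (1 - s) * enorm (y - z) ^+ 2.
  by rewrite mulr_ge0 ?sqr_ge0 // mulr_ge0 //; lra.
by rewrite !sqr_enorm !dotE (dotC z y); lra.
Qed.

(** For z = (x, t), the function |z - (y, g(y))| of y is continuous, and outside
    the box of radius |t - g(x)| centered at x it exceeds its value at y = x. *)
Lemma nearest_graph_point (R : realType) (n : nat) (g : 'rV[R]_n -> R)
    (z : 'rV[R]_(n + 1)) : continuous g ->
  exists2 p, graph_of g p & dist_to (graph_of g) z = enorm (z - p).
Proof.
move=> cg; have [x [t ->]] := ptP z.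
pose phi y := enorm (pt x t - pt y (g y)) ^+ 2.
have phiE y : phi y = \sum_i (x ord0 i - y ord0 i) ^+ 2 + (t - g y) ^+ 2.
  rewrite /phi ptB sqr_enorm_pt; congr (_ + _).
  by apply: eq_bigr => i _; rewrite !mxE expr2.
pose rho := `|t - g x|.
pose box := [set y : 'rV[R]_n | forall i,
  `[x ord0 i - rho, x ord0 i + rho]%classic (y ord0 i)].
have cphi : continuous phi.
  have -> : phi = fun y => enorm (x - y) ^+ 2 + (t - g y) * (t - g y).
    by apply/funext => y; rewrite /phi ptB sqr_enorm_pt sqr_enorm expr2.
  have cgt : continuous (fun y => t - g y).
    by move=> y; exact: (continuousB (@cst_continuous _ R^o t y) (cg y)).
  have cxy : continuous (fun y : 'rV[R]_n => x - y).
    move=> y; have cid : {for y, continuous (@id 'rV[R]_n)} by exact: cvg_id.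
    exact: (continuousB (@cst_continuous _ _ x y) cid).
  move=> y; have c2 := continuousM (cgt y) (cgt y).
  have c1 := continuous_comp (cxy y) (@sqr_enorm_continuous R n (x - y)).
  exact: (continuousD c1 c2).
have rho0 : 0 <= rho by exact: normr_ge0.
have box_x : box x by move=> i /=; rewrite in_itv /=; lra.
have [|||y _ ymin] := @EVT_min_rV R n phi box.
- by exists x.
- exact: (rV_compact (fun i =>
    @segment_compact R (x ord0 i - rho) (x ord0 i + rho))).
- exact: continuous_subspaceT.
(* Outside the box, some coordinate alone makes phi exceed phi x = rho^2. *)
have {}ymin w : phi y <= phi w.
  have [wbox|wbox] := pselect (box w); first by apply: ymin; rewrite inE.
  apply: (@le_trans _ _ (phi x)); first by apply: ymin; rewrite inE.
  have [i xwi] : exists i, rho < `|x ord0 i - w ord0 i|.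
    apply: contrapT => far; apply: wbox => i /=; rewrite in_itv /=.
    have : `|x ord0 i - w ord0 i| <= rho.
      by rewrite leNgt; apply/negP => ?; apply: far; exists i.
    by rewrite ler_norml; lra.
  rewrite !phiE big1 ?add0r => [|j _]; last by rewrite subrr expr0n.
  rewrite (bigD1 i) //= -addrA -(real_normK (num_real (t - g x))) -/rho.
  apply: (@le_trans _ _ ((x ord0 i - w ord0 i) ^+ 2)).
    rewrite -(real_normK (num_real (x ord0 i - w ord0 i))).
    by rewrite lerXn2r ?nnegrE ?normr_ge0 // ltW.
  by rewrite lerDl addr_ge0 ?sqr_ge0 // sumr_ge0 // => j _; exact: sqr_ge0.
exists (pt y (g y)); first exact: graph_of_pt.
apply/le_anti/andP; split; first by apply: dist_to_le; exact: graph_of_pt.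
apply: le_dist_to; first by exists (pt y (g y)); exact: graph_of_pt.
move=> _ [w _ <-]; apply: ler_sqr_ge0; first exact: enorm_ge0.
exact: ymin.
Qed.

Lemma enorm_le_mx_norm (R : realType) (k : nat) (x : 'rV[R]_k) :
  enorm x <= k%:R * `|x|.
Proof.
case: k x => [|k] x.
  by rewrite /enorm big_ord0 sqrtr0 mul0r.
apply: ler_sqr_ge0; first by rewrite mulr_ge0.
rewrite sqr_enorm exprMn (@le_trans _ _ (k.+1%:R * `|x| ^+ 2)) //.
  rewrite mulr_natl -[X in _ *+ X]card_ord -sumr_const.
  apply: ler_sum => i _; rewrite -expr2 -(real_normK (num_real (x ord0 i))).
  rewrite lerXn2r ?nnegrE //.
  by rewrite -[leRHS]/(mx_norm x) mx_normrE; exact: (le_bigmax _ _ (ord0, i)).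
by rewrite ler_wpM2r ?sqr_ge0 // -natrX ler_nat expnS expn1 leq_pmulr.
Qed.

(** A point of the closure has distance 0 from A, so it is its own nearest point
    in A. *)
Lemma closed_attained (R : realType) (d : nat) (A : set 'rV[R]_d) :
  (forall z, exists2 p, A p & dist_to A z = enorm (z - p)) -> closed A.
Proof.
move=> nearest z Az; have [p Ap zp] := nearest z.
suff /enorm_eq0 /eqP : enorm (z - p) = 0.
  by rewrite subr_eq0 => /eqP ->.
apply/le_anti; rewrite enorm_ge0 andbT; apply/ler_addgt0Pl => e e0.
have d1 : 0 < d%:R + 1 :> R by rewrite ltr_wpDl.
have [q [Aq]] := Az _ (nbhsx_ballx z _ (divr_gt0 e0 d1)).
rewrite -ball_normE /= ltr_pdivlMr // => zq.
rewrite -zp addr0; apply: le_trans (dist_to_le z Aq) _.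
apply: le_trans (enorm_le_mx_norm _) _.
by have := normr_ge0 (z - q); lra.
Qed.

(** Divide by e and let e tend to 0. *)
Lemma first_order_nonpos (R : realType) (L Q : R) : 0 <= Q ->
  (forall e, 0 < e -> e <= 1 -> 2 * e * L <= e ^+ 2 * Q) -> L <= 0.
Proof.
move=> Q0 small; rewrite leNgt; apply/negP => L0.
have LQ : 0 < L + Q by lra.
have [e [e0 e1 eLQ]] : exists e, [/\ 0 < e, e <= 1 & e * (L + Q) = L].
  exists (L / (L + Q)); rewrite divr_gt0 // ler_pdivrMr // divfK ?gt_eqF //.
  by split=> //; lra.
have := small e e0 e1; have := mulr_gt0 e0 L0.
have -> : e ^+ 2 * Q = e * (e * (L + Q)) - e * (e * L) by ring.
rewrite eLQ.
have := mulr_gt0 e0 (mulr_gt0 e0 L0).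
lra.
Qed.

(** Let z - p = (w, om) with p = (x0, g(x0)), and let y = x0 + m. Convexity of h
    bounds g(x0 + e m) - g(x0) below by e D, where
    D = g(y) - g(x0) - a |m|^2, so the points p + (e m, e D) with 0 < e <= 1
    belong to K. They are not closer to z than p, which to first order in e
    says that <w, m> + om D <= 0. Hence <w, m> + om (g(y) - g(x0)) is at most
    a om |m|^2, and this quadratic bound says that the ball of radius 1/(2a)
    touching K at p avoids (y, g(y)) and all points below it. Points straight
    below p show that om >= 0. *)
Lemma rolling_ball (R : realType) (n : nat) (g h : 'rV[R]_n -> R) (a : R)
    (z p : 'rV[R]_(n + 1)) :
  0 < a -> convex_function setT h ->
  (forall x, g x = a * enorm x ^+ 2 - h x) ->
  ~ hypograph g z -> graph_of g p ->
  (forall q, hypograph g q -> enorm (z - p) <= enorm (z - q)) ->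
  forall q, hypograph g q ->
    (2 * a)^-1 <= enorm (p + ((2 * a)^-1 / enorm (z - p)) *: (z - p) - q).
Proof.
move=> a0 /convex_functionP ch gE nKz [x0 _ <-].
rewrite -/(pt x0 (g x0)) => nearest q Kq.
have s0 : 0 < enorm (z - pt x0 (g x0)).
  rewrite lt_def enorm_ge0 andbT; apply/eqP => /enorm_eq0 /eqP.
  rewrite subr_eq0 => /eqP zp; apply: nKz; rewrite zp.
  exact/hypograph_pt.
have [x [t zE]] := ptP z; have [y [tau qE]] := ptP q.
subst z q; move: Kq => /hypograph_pt Kq.
set s := enorm (pt x t - _) in nearest s0 *.
have [w wE] : exists w, w = x - x0 by exists (x - x0).
have [om omE] : exists om, om = t - g x0 by exists (t - g x0).
have s2 : s ^+ 2 = dot w w + om ^+ 2.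
  by rewrite /s ptB sqr_enorm_pt wE omE.
have test (m : 'rV[R]_n) (b : R) : g x0 + b <= g (x0 + m) ->
    2 * (dot w m + om * b) <= dot m m + b ^+ 2.
  move=> /hypograph_pt /nearest; rewrite -/s => sm.
  have : s ^+ 2 <= enorm (pt x t - pt (x0 + m) (g x0 + b)) ^+ 2.
    by rewrite lerXn2r ?nnegrE ?enorm_ge0.
  rewrite s2 ptB sqr_enorm_pt !opprD !addrA -wE -omE !dotE (dotC m w).
  by lra.
have om0 : 0 <= om.
  rewrite -oppr_le0; apply: (@first_order_nonpos R _ 1) => // e e0 _.
  have := test 0 (- e); rewrite addr0 -(scale0r 0) !dotE !mul0r.
  move=> /(_ _)/wrap[].
    by lra.
  by rewrite sqrrN; lra.
have oms : om <= s.
  apply: ler_sqr_ge0; first exact: ltW.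
  by rewrite s2 lerDr -sqr_enorm sqr_ge0.
have [m mE] : exists m, m = y - x0 by exists (y - x0).
pose D := 2 * a * dot x0 m - (h y - h x0).
have gD e : 0 <= e -> e <= 1 ->
    e * D + a * e ^+ 2 * dot m m <= g (x0 + e *: m) - g x0.
  move=> e0 e1; have := ch y x0 e e0 e1.
  have -> : e *: y + (1 - e) *: x0 = x0 + e *: m.
    by rewrite scalerBl scale1r mE scalerBr addrCA.
  by rewrite !gE !sqr_enorm !dotE (dotC m x0) /D; lra.
have mm0 : 0 <= dot m m by rewrite -sqr_enorm sqr_ge0.
have normal : dot w m + om * D <= 0.
  apply: (@first_order_nonpos R _ (dot m m + D ^+ 2)).
    by rewrite addr_ge0 ?sqr_ge0.
  move=> e e0 e1.
  have mm : 0 <= a * e ^+ 2 * dot m m.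
    exact: mulr_ge0 (mulr_ge0 (ltW a0) (sqr_ge0 e)) mm0.
  have := test (e *: m) (e * D) => /(_ _)/wrap[].
    by have := gD e (ltW e0) e1; lra.
  by rewrite !dotE; lra.
pose delta := tau - g x0.
have deltaD : delta <= D + a * dot m m.
  have yy : dot y y = dot x0 x0 + 2 * dot x0 m + dot m m.
    have -> : y = x0 + m by rewrite mE (addrC x0) subrK.
    by rewrite !dotE (dotC m x0); lra.
  by move: Kq; rewrite /delta /D !gE !sqr_enorm yy; lra.
have key : 2 * (2 * a)^-1 * (dot w m + om * delta) <= s * dot m m.
  have r0 : 0 < (2 * a)^-1 by rewrite invr_gt0; lra.
  have ra : 2 * (2 * a)^-1 * a = 1 by field; lra.
  have h1 := ler_wpM2l om0 deltaD.
  have h2 : dot w m + om * delta <= om * (a * dot m m) by lra.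
  have := ler_wpM2l (_ : 0 <= 2 * (2 * a)^-1) h2 => /(_ _)/wrap[]; first by lra.
  have -> : 2 * (2 * a)^-1 * (om * (a * dot m m)) =
    2 * (2 * a)^-1 * a * (om * dot m m) by ring.
  rewrite ra mul1r => /le_trans; apply.
  exact: ler_wpM2r.
apply: ler_sqr_ge0; first exact: enorm_ge0.
set r := (2 * a)^-1 in key *.
have rs : r / s * s = r by rewrite divfK // gt_eqF.
have -> : pt x0 (g x0) + (r / s) *: (pt x t - pt x0 (g x0)) - pt y tau
    = pt ((r / s) *: w - m) (r / s * om - delta).
  by rewrite ptB ptZ ptD ptB -wE -omE mE /delta !opprB !addrA;
    congr pt; [rewrite addrAC addrC addrA | lra].
rewrite sqr_enorm_pt !dotE (dotC m w).
have key' : 2 * (r / s) * (dot w m + om * delta) <= dot m m.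
  rewrite -(ler_pM2l s0).
  have -> : s * (2 * (r / s) * (dot w m + om * delta)) =
    2 * (r / s * s) * (dot w m + om * delta) by ring.
  by rewrite rs.
have r2 : r ^+ 2 = (r / s) ^+ 2 * (dot w w + om ^+ 2) by rewrite -s2 -exprMn rs.
by have := sqr_ge0 delta; rewrite r2; lra.
Qed.

Theorem corollary4p5 (R : realType) (n : nat) (hd : (2 <= n + 1)%N)
    (g : 'rV[R]_n -> R) (hg : semiconcave setT g) :
  in_D (graph_of g).
Proof.
have [a [h [a0 ch gE]]] := hg.
have {}gE x : g x = a * enorm x ^+ 2 - h x by exact: gE.
have cg : continuous g.
  have -> : g = fun x => a * enorm x ^+ 2 - h x by apply/funext.
  move=> x; have ch' := convex_continuous ch.
  have c1 := continuousM (@cst_continuous _ R^o a x)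
    (@sqr_enorm_continuous R n x).
  exact: (continuousB c1 (ch' x)).
have nearest z := nearest_graph_point z cg.
have A0 : graph_of g !=set0 by exists (pt 0 (g 0)); exact: graph_of_pt.
right; split=> //; first exact: closed_attained.
apply: (DC_dist_of_rolling_ball (K := hypograph g) (r := (2 * a)^-1)) => //.
- by rewrite invr_gt0; lra.
- by move=> _ [x _ <-]; apply/hypograph_pt.
- by move=> z w; exact: segment_meets_graph.
- move=> _ e [x _ <-] e0; exists (pt x (g x + e)).
    by move=> /hypograph_pt; lra.
  apply: ler_sqr_ge0; first exact: ltW.
  rewrite -/(pt x (g x)) ptB sqr_enorm_pt subrr -(scale0r 0) dotZl.
  by lra.
- by move=> z p; exact: rolling_ball a0 ch gE.
Qed.
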